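(* Let $V=K^n_\phi$ be a two-sided vector space with $[V]=l_1[S_1]+\cdots+l_r[S_r]$, where $S_1,\dots,S_r$ are non-isomorphic simple two-sided vector spaces, and let $W$ be a two-sided vector space. If $K/k$ is finite and Galois then $F_\phi([W],V)=G_\phi([W],V)=H_\phi([W],V)$, and $\mathbb{F}_\phi(q_1[S_1]+\cdots+q_r[S_r],V)$ equals $$\prod_{i=1}^r\mathbb{G}(q_i,l_i)$$ (product over $\operatorname{Spec}K$).
   Context: $k\subset K$ is a field extension. A two-sided vector space is a $k$-central $K$-$K$-bimodule finite-dimensional as a left $K$-module; $\dim_K$ is left dimension. For a $k$-algebra homomorphism $\phi:K\to M_n(K)$, $K^n_\phi$ is $K^n$ (row vectors) with the usual left action and right action $v\cdot x=v\phi(x)$. The rank $[W]$ is the class of $W$ in the Grothendieck group $K_0$ of the category of two-sided vector spaces, i.e. the sum of the classes of its simple composition factors with multiplicity. $V$ is $S$-homogeneous if all its composition factors are isomorphic to the simple $S$. Every $V$ decomposes as $V=V_1\oplus\cdots\oplus V_r$ with $V_i$ $S_i$-homogeneous, $S_i$ pairwise non-isomorphic simples; let $m_i=\dim_KS_i$, $n_i=\dim_KV_i=l_im_i$, and let $\phi_i:K\to M_{n_i}(K)$ be the restriction of $\phi$ to $V_i$. For a $k$-algebra $A\subset M_n(K)$ and a commutative $K$-algebra $R$: $G(m,n)(R)$ is the set of free rank $m$ direct summands of $R^n$ (functorial by pullback), taken as the functor of points of the Grassmannian $\mathbb{G}(m,n)$; $F_A(m,n)(R)$ is the subset of those $M$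 with $Ma\subset M$ for all $a\in A$; $G_A(m,n)(R)$ is the subset of those $M$ generated by $A$-invariants, meaning that the image of $\bigwedge^mM$ in $\bigwedge^mR^n\cong R\otimes_K\bigwedge^mK^n$ has an $R$-module generator of the form $\sum_ir_i\otimes v_{i1}\wedge\cdots\wedge v_{im}$ with each $\{v_{i1},\dots,v_{im}\}$ a basis of a rank $m$ $A$-invariant subspace of $K^n$; $H_A(m,n)(R)=F_A(m,n)(R)\cap G_A(m,n)(R)$. For $X\in\{F,G,H\}$: if $[W]=q_1[S_1]+\cdots+q_r[S_r]$, then $X_\phi([W],V)=\prod_{i=1}^rX_{\operatorname{im}\phi_i}(q_im_i,n_i)$ (product over $h_{\operatorname{Spec}K}$); if $W$ has a composition factor not among $S_1,\dots,S_r$, then $X_\phi([W],V)(R)=\emptyset$. $\mathbb{F}_\phi([W],V)$ denotes the scheme representing $F_\phi([W],V)$. *)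

(* Defs.v *)
From HB Require Import structures.
From mathcomp Require Import all_boot all_order all_fingroup all_algebra all_field.
From mathcomp Require Import classical_sets functions.

Set Implicit Arguments.
Unset Strict Implicit.
Unset Printing Implicit Defensive.

Import GRing.Theory.
Local Open Scope classical_set_scope.
Local Open Scope ring_scope.

(* Two-sided vector spaces: [bact v x] is the right action v . x, and the left
   dimension is the dimension of the underlying vectType. *)
Record bimod (k : fieldType) (K : fieldExtType k) := Bimod {
  bsort :> vectType K;
  bact : bsort -> K -> bsort;
  bactDl : forall u v x, bact (u + v) x = bact u x + bact v x;
  bactDr : forall v x y, bact v (x + y) = bact v x + bact v y;
  bact1 : forall v, bact v 1 = v;
  bactM : forall v x y, bact v (x * y) = bact (bact v x) y;
  bactZ : forall a v x, bact (a *: v) x = a *: bact v x;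
  bact_central : forall v (c : k), bact v c%:A = (c%:A : K) *: v
}.

Section Bimodules.
Variables (k : fieldType) (K : fieldExtType k).
Implicit Types V W S T : bimod K.

Definition equivariant V W (f : 'Hom(V, W)) : Prop :=
  forall v x, f (bact v x) = bact (f v) x.

Definition bimod_iso V W : Prop :=
  exists2 f : 'Hom(V, W), equivariant f & lker f = 0%VS /\ limg f = fullv.

Definition short_exact W' W S : Prop :=
  exists (f : 'Hom(W', W)) (g : 'Hom(W, S)),
    [/\ equivariant f, equivariant g, lker f = 0%VS, limg f = lker g
      & limg g = fullv].

Definition simple_bimod S : Prop :=
  \dim {:S} != 0%N /\
  forall U : {vspace S}, (forall v x, v \in U -> bact v x \in U) ->
    U = 0%VS \/ U = fullv.

(* [comp_series W s]: W has a composition series whose successive factors are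
   isomorphic to the terms of s (the top one first). *)
Inductive comp_series : bimod K -> seq (bimod K) -> Prop :=
| Comp_nil W : \dim {:W} = 0%N -> comp_series W [::]
| Comp_cons W' W S s : simple_bimod S -> short_exact W' W S ->
    comp_series W' s -> comp_series W (S :: s).

Definition comp_factor W T : Prop :=
  exists s1 s2, comp_series W (s1 ++ T :: s2).

Definition homogeneous S V : Prop := forall T, comp_factor V T -> bimod_iso T S.

(* [W] = \sum_i q_i [S_i] in the Grothendieck group, the S_i being pairwise
   non-isomorphic simples. *)
Definition rank_eq r W (S : 'I_r -> bimod K) (q : 'I_r -> nat) : Prop :=
  exists2 t : seq 'I_r,
    comp_series W [seq S i | i <- t] & forall i, count_mem i t = q i.

(* k-algebra homomorphisms K -> 'M[K]_n; k acts on matrices through K. *)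
Definition alghom n := {lrmorphism K -> 'M[K]_n | (in_alg K) \; *:%R}.

Section OfHom.
Variables (n : nat) (phi : alghom n).

Let act (v : 'rV[K]_n) (x : K) : 'rV[K]_n := v *m phi x.

Fact bimod_of_Dl u v x : act (u + v) x = act u x + act v x.
Proof. exact: mulmxDl. Qed.
Fact bimod_of_Dr v x y : act v (x + y) = act v x + act v y.
Proof. by rewrite /act raddfD mulmxDr. Qed.
Fact bimod_of_1 v : act v 1 = v.
Proof. by rewrite /act rmorph1 mulmx1. Qed.
Fact bimod_of_M v x y : act v (x * y) = act (act v x) y.
Proof. by rewrite /act rmorphM mulmxA. Qed.
Fact bimod_of_Z a v x : act (a *: v) x = a *: act v x.
Proof. by rewrite /act scalemxAl. Qed.
Fact bimod_of_central v (c : k) : act v c%:A = (c%:A : K) *: v.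
Proof. by rewrite /act linearZ /= rmorph1 -scalemxAr mulmx1. Qed.

(* K^n_phi *)
Definition bimod_of : bimod K :=
  Bimod bimod_of_Dl bimod_of_Dr bimod_of_1 bimod_of_M bimod_of_Z bimod_of_central.
End OfHom.

(* The decomposition of V = K^n_phi into S_i-homogeneous parts V_i.  The rows of
   [dec_basis i] are a basis of V_i, through which V_i is identified with
   K^(n_i)_(phi_i). *)
Record decomposition n (phi : alghom n) r (S : 'I_r -> bimod K) := Decomposition {
  dec_dim : 'I_r -> nat;
  dec_basis : forall i, 'M[K]_(dec_dim i, n);
  dec_hom : forall i, alghom (dec_dim i);
  dec_free : forall i, row_free (dec_basis i);
  dec_homE : forall i x, dec_hom i x *m dec_basis i = dec_basis i *m phi x;
  dec_direct : mxdirect (\sum_i <<dec_basis i>>)%MS;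
  dec_full : row_full (\sum_i <<dec_basis i>>)%MS;
  dec_homog : forall i, homogeneous (S i) (bimod_of (dec_hom i))
}.

End Bimodules.

(* Commutative K-algebras.  The zero ring is allowed, unlike in comAlgType. *)
Record kalg (K : fieldType) := KAlg {
  kalg_ring :> comPzRingType;
  kalg_in : {rmorphism K -> kalg_ring}
}.

Definition is_kalg_hom (K : fieldType) (R R' : kalg K) (f : {rmorphism R -> R'})
  : Prop := forall x, f (kalg_in R x) = kalg_in R' x.

Section Submodules.
Variable R : comPzRingType.

Definition is_submod n (M : set 'rV[R]_n) : Prop :=
  M 0 /\ forall a u v, M u -> M v -> M (a *: u + v).

Definition rspan n (X : set 'rV[R]_n) : set 'rV[R]_n :=
  [set w | exists t (c : 'rV[R]_t) (U : 'M[R]_(t, n)),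
     (forall j, X (row j U)) /\ w = c *m U].

Definition direct_summand n (M : set 'rV[R]_n) : Prop :=
  is_submod M /\
  exists N, [/\ is_submod N, M `&` N = [set 0]
              & forall w, exists u v, [/\ M u, N v & w = u + v]].

Definition free_of_rank m n (M : set 'rV[R]_n) : Prop :=
  exists B : 'M[R]_(m, n),
    injective (fun c : 'rV[R]_m => c *m B) /\ M = range (fun c : 'rV[R]_m => c *m B).

(* The exterior power of R^n is free on the e_f, f : 'I_m -> 'I_n increasing;
   the coordinates of the wedge product of the rows of U are its minors. *)
Definition incr m n :=
  {f : {ffun 'I_m -> 'I_n} | [forall i : 'I_m, forall j : 'I_m, (i < j)%N ==> (f i < f j)%N]}.

Definition wedge m n (U : 'M[R]_(m, n)) : 'rV[R]_#|{: incr m n}| :=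
  \row_(s < #|{: incr m n}|) \det (colsub (val (enum_val s)) U).

(* image of the m-th exterior power of M in that of R^n *)
Definition ext_image m n (M : set 'rV[R]_n) : set 'rV[R]_#|{: incr m n}| :=
  rspan (@wedge m n @` [set U | forall j, M (row j U)]).

End Submodules.

Arguments ext_image {R} m {n} M.

(* Pullback along f : R -> R' of a direct summand M of R^n: the image of
   R' (x)_R M in R'^n. *)
Definition pullback (R R' : comPzRingType) (f : {rmorphism R -> R'}) n
  (M : set 'rV[R]_n) : set 'rV[R']_n := rspan (map_mx f @` M).

Section Functors.
Variable K : fieldType.
Implicit Type R : kalg K.

Definition Gr m n R : set (set 'rV[R]_n) :=
  [set M | free_of_rank m M /\ direct_summand M].
Arguments Gr : clear implicits.

Definition FA n (A : set 'M[K]_n) m R : set (set 'rV[R]_n) :=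
  [set M | Gr m n R M /\
     forall a u, A a -> M u -> M (u *m map_mx (kalg_in R) a)].
Arguments FA {n} A m R.

(* r (x) v_1 /\ ... /\ v_m is sent to r (v_1 /\ ... /\ v_m) in the exterior
   power of R^n *)
Definition inv_generated n (A : set 'M[K]_n) m R (M : set 'rV[R]_n) : Prop :=
  exists t (c : 'I_t -> R) (v : 'I_t -> 'M[K]_(m, n)),
    (forall j, row_free (v j) /\ forall a, A a -> stablemx (v j) a) /\
    ext_image m M = rspan [set \sum_j c j *: wedge (map_mx (kalg_in R) (v j))].

Definition GA n (A : set 'M[K]_n) m R : set (set 'rV[R]_n) :=
  [set M | Gr m n R M /\ inv_generated A m M].
Arguments GA {n} A m R.

Definition HA n (A : set 'M[K]_n) m R : set (set 'rV[R]_n) :=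
  FA A m R `&` GA A m R.
Arguments HA {n} A m R.

(* Families (M_i)_i of submodules of the R^(d i); every functor below is given
   by a subset of these, and acts on morphisms by [pullback_fam]. *)
Definition fam r (d : 'I_r -> nat) R := forall i, set 'rV[R]_(d i).

Definition pullback_fam r (d : 'I_r -> nat) R R' (f : {rmorphism R -> R'})
  (M : fam d R) : fam d R' := fun i => pullback f (M i).

(* product of the Grassmannians G(q_i, d_i) *)
Definition prod_Gr r (q d : 'I_r -> nat) R : set (fam d R) :=
  [set M | forall i, Gr (q i) (d i) R (M i)].
Arguments prod_Gr {r} q d R.

(* isomorphism of functors on commutative K-algebras, i.e. of the K-schemes of
   which they are the functors of points *)
Definition nat_iso r (d d' : 'I_r -> nat)
  (X : forall R, set (fam d R)) (Y : forall R, set (fam d' R)) : Prop :=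
  exists eta : forall R, fam d R -> fam d' R,
    (forall R, set_bij (X R) (Y R) (eta R)) /\
    (forall R R' (f : {rmorphism R -> R'}), is_kalg_hom f ->
      forall M, X R M -> eta R' (pullback_fam f M) = pullback_fam f (eta R M)).

End Functors.

Arguments Gr {K} m n R.
Arguments FA {K n} A m R.
Arguments GA {K n} A m R.
Arguments HA {K n} A m R.
Arguments prod_Gr {K r} q d R.

Section RankFunctors.
Variables (k : fieldType) (K : fieldExtType k) (n : nat) (phi : alghom K n).
Variables (r : nat) (S : 'I_r -> bimod K) (D : decomposition phi S).
Implicit Types (W : bimod K) (R : kalg K).

(* X_phi([W], V) for X = F, G, H: there is a (unique) q with
   [W] = \sum_i q_i [S_i] unless W has a composition factor not among the S_i,
   in which case this is the empty set. *)
Definition Xphi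
  (X : forall d, set 'M[K]_d -> nat -> forall R, set (set 'rV[R]_d))
  W R : set (fam (dec_dim D) R) :=
  [set M | exists2 q, rank_eq W S q &
     forall i, X _ (range (dec_hom D i)) (q i * \dim {:S i})%N R (M i)].

Definition Fphi := Xphi (@FA K).
Definition Gphi := Xphi (@GA K).
Definition Hphi := Xphi (@HA K).

End RankFunctors.

Arguments Fphi {k K n phi r S} D W R.
Arguments Gphi {k K n phi r S} D W R.
Arguments Hphi {k K n phi r S} D W R.

(* Main.v *)
From HB Require Import structures.
Require Import Defs.
From mathcomp Require Import all_boot all_order all_fingroup all_algebra all_field.
From mathcomp Require Import boolp classical_sets functions.

(* For K/k finite Galois with basis b_i, the matrix (s(b_i)), s in Gal(K/k), is
   invertible; if C is its inverse, v |-> \sum_i C_(i,s) v.b_i projects any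
   two-sided vector space V onto the subspace on which x acts on the right as
   left multiplication by s(x).  These projections are natural and sum to 1, so
   the dimensions of their images are additive on exact sequences: they give the
   multiplicities of the composition factors.  Simple objects are therefore
   one-dimensional, each determined by some s, V_i has dimension l_i, and
   im phi_i consists of scalar matrices.  Then every subspace of V_i is invariant
   and the three functors all reduce to products of Grassmannians. *)

Set Implicit Arguments.
Unset Strict Implicit.
Unset Printing Implicit Defensive.

Import GRing.Theory.
Local Open Scope ring_scope.

(** * The Galois group and its dual family *)

Section GaloisDual.
Variables (k : fieldType) (K : splittingFieldType k).
Local Notation G := (gal_of {:K}).

Lemma gal_inA (s : G) (c : k) : s c%:A = c%:A.
Proof. by rewrite linearZ /= rmorph1. Qed.

(** Makes [gal_mx] square: every element of [gal_of {:K}] fixes k pointwise, so the Galois group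
    over k is the whole type. *)
Lemma card_gal : galois 1%VS {:K}%VS -> #|{: G}| = \dim {:K}.
Proof.
move=> galK; have := galois_dim galK; rewrite dimv1 divn1 => ->.
apply: eq_card => s; rewrite inE gal_kHom ?sub1v //.
by apply/esym/kAHomP => _ /vlineP[c ->]; rewrite gal_inA.
Qed.

Let N := \dim {:K}.
Let b (i : 'I_N) : K := (vbasis {:K})`_i.

(* Unit by Dedekind's independence of characters; its inverse is the family [C] below. *)
Definition gal_mx (e : #|{: G}| = N) : 'M[K]_N :=
  \matrix_(j, i) (enum_val (cast_ord (esym e) j) : G) (b i).

Lemma gal_mx_unit (e : #|{: G}| = N) : gal_mx e \in unitmx.
Proof.
rewrite -row_free_unit; apply: inj_row_free => u uT0.
pose c (s : G) := u 0 (cast_ord e (enum_rank s)).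
(* A row killed by [gal_mx] is a linear relation between the automorphisms on the basis; by
   k-linearity it holds on all of K. *)
have csum a : a \in {:K}%VS -> \sum_(s : G) c s * s a = 0.
  move=> /coord_vbasis ->.
  under eq_bigr => s _ do rewrite linear_sum mulr_sumr.
  rewrite exchange_big big1 //= => i _.
  under eq_bigr => s _ do rewrite linearZ /= -scalerAr.
  rewrite -scaler_sumr.
  have/rowP/(_ i) := uT0; rewrite !mxE => ui0.
  suff -> : \sum_(s : G) c s * s (vbasis {:K})`_i = 0 by rewrite scaler0.
  rewrite -[RHS]ui0 (reindex (fun j => enum_val (cast_ord (esym e) j))) /=.
    by apply: eq_bigr => j _; rewrite !mxE /c enum_valK cast_ordKV.
  exists (fun s => cast_ord e (enum_rank s)) => [j _ | s _].
    by rewrite enum_valK cast_ordKV.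
  by rewrite cast_ordK enum_rankK.
apply/rowP => j; rewrite mxE.
have := gal_independent csum (x := enum_val (cast_ord (esym e) j)) isT.
by rewrite /c enum_valK cast_ordKV.
Qed.

(** The two identities say that [gal_mx] times its inverse is 1, in either order; the second one is
    extended from the basis to x by k-linearity. *)
Lemma gal_dual : galois 1%VS {:K}%VS ->
  exists C : 'I_N -> G -> K,
    (forall s t : G, \sum_i C i s * t (b i) = (s == t)%:R) /\
    (forall x i, \sum_s C i s * s x = (coord (vbasis {:K}) i x)%:A).
Proof.
move=> /card_gal e; pose T := gal_mx e; have uT : T \in unitmx := gal_mx_unit e.
pose f (s : G) := cast_ord e (enum_rank s).
have Tf s i : T (f s) i = s (b i) by rewrite mxE cast_ordK enum_rankK.
exists (fun i s => invmx T i (f s)); split.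
  move=> s t; have /matrixP/(_ (f t) (f s)) := mulmxV uT.
  rewrite !mxE (inj_eq (@cast_ord_inj _ _ e)) (inj_eq enum_rank_inj) eq_sym => <-.
  by apply: eq_bigr => i _; rewrite Tf mulrC.
have C_b i j : \sum_s invmx T i (f s) * s (b j) = (i == j)%:R.
  have /matrixP/(_ i j) := mulVmx uT; rewrite !mxE => <-.
  under eq_bigr => s _ do rewrite -Tf.
  rewrite [RHS](reindex f) //=.
  by exists (fun j => enum_val (cast_ord (esym e) j)) => s _;
    rewrite /f ?enum_valK ?cast_ordK ?cast_ordKV ?enum_rankK.
move=> x i; rewrite {1}(coord_vbasis (memvf x)).
under eq_bigr => s _ do rewrite linear_sum mulr_sumr.
rewrite exchange_big /= (bigD1 i) //= [X in _ + X]big1 ?addr0 => [|j ji];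
  under eq_bigr => s _ do rewrite linearZ /= -scalerAr.
  by rewrite -scaler_sumr C_b eqxx.
by rewrite -scaler_sumr C_b eq_sym (negPf ji) scaler0.
Qed.

End GaloisDual.

(** * Right actions as linear maps, and sub-bimodules *)

Section Bimod.
Variables (k : fieldType) (K : fieldExtType k).
Implicit Types V W : bimod K.

Definition ract V x (v : V) : V := bact v x.

Lemma ract_is_linear V x : linear (@ract V x).
Proof. by move=> a u v; rewrite /ract bactDl bactZ. Qed.
HB.instance Definition _ V x :=
  GRing.isLinear.Build K V V *:%R (@ract V x) (@ract_is_linear V x).

Lemma bact0l V x : bact (0 : V) x = 0.
Proof. exact: (raddf0 (@ract V x)). Qed.

Lemma bact_suml V I (r : seq I) (F : I -> V) x :
  bact (\sum_(i <- r) F i) x = \sum_(i <- r) bact (F i) x.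
Proof. exact: (linear_sum (@ract V x)). Qed.

Lemma bact_sumr V I (r : seq I) (F : I -> K) (v : V) :
  bact v (\sum_(i <- r) F i) = \sum_(i <- r) bact v (F i).
Proof.
apply: (big_morph (bact v)) => [x y|]; first exact: bactDr.
by apply: (addrI (bact v 0)); rewrite -bactDr !addr0.
Qed.

Lemma bact_alg V (v : V) (c : k) x : bact v (c *: x) = c%:A *: bact v x.
Proof. by rewrite -[c *: x]mulr_algl mulrC bactM bact_central. Qed.

Section Sub.
Variables (V : bimod K) (U : {vspace V}).
Hypothesis stU : forall v x, v \in U -> bact v x \in U.

Let act (w : subvs_of U) x : subvs_of U := vsproj U (bact (vsval w) x).

Let val_act w x : vsval (act w x) = bact (vsval w) x.
Proof. by rewrite vsprojK // stU // subvsP. Qed.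

Fact sub_bimodDl u v x : act (u + v) x = act u x + act v x.
Proof. by rewrite /act linearD bactDl linearD. Qed.
Fact sub_bimodDr v x y : act v (x + y) = act v x + act v y.
Proof. by rewrite /act bactDr linearD. Qed.
Fact sub_bimod1 v : act v 1 = v.
Proof. by rewrite /act bact1 vsvalK. Qed.
Fact sub_bimodM v x y : act v (x * y) = act (act v x) y.
Proof. by apply: subvs_inj; rewrite !val_act bactM. Qed.
Fact sub_bimodZ a v x : act (a *: v) x = a *: act v x.
Proof. by rewrite /act !linearZ /= bactZ linearZ. Qed.
Fact sub_bimod_central v (c : k) : act v c%:A = (c%:A : K) *: v.
Proof. by rewrite /act bact_central linearZ /= vsvalK. Qed.

Definition sub_bimod : bimod K :=
  Bimod sub_bimodDl sub_bimodDr sub_bimod1 sub_bimodM sub_bimodZ sub_bimod_central.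

Lemma val_sub_bimod (w : sub_bimod) x : vsval (bact w x) = bact (vsval w) x.
Proof. exact: val_act. Qed.

Lemma dim_sub_bimod : \dim {:sub_bimod} = \dim U.
Proof. by rewrite dimvf. Qed.

End Sub.
End Bimod.

(** * Isotypic components and composition series *)

Section Isotypic.
Variables (k : fieldType) (K : splittingFieldType k).
Local Notation G := (gal_of {:K}).
Local Notation N := (\dim {:K}).
Local Notation b := (vbasis {:K}).
Variable C : 'I_N -> G -> K.
Hypothesis C_delta : forall s t : G, \sum_i C i s * t b`_i = (s == t)%:R.
Hypothesis C_coord : forall x i, \sum_(s : G) C i s * s x = (coord b i x)%:A.
Implicit Types (V W S T : bimod K) (s t : G).

(* The component of [v] on which [x] acts on the right as [s x] does on the left. *)
Definition isoproj V s (v : V) : V := \sum_i C i s *: bact v b`_i.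

Lemma isoproj_is_linear V s : linear (@isoproj V s).
Proof.
move=> a u v; rewrite /isoproj scaler_sumr -big_split /=.
apply: eq_bigr => i _.
by rewrite bactDl bactZ scalerDr !scalerA mulrC.
Qed.
HB.instance Definition _ V s :=
  GRing.isLinear.Build K V V *:%R (@isoproj V s) (@isoproj_is_linear V s).

(** Expand x in the basis: [C_coord] writes each coordinate as a sum over s, and exchanging the sums
    collects the projections. *)
Lemma isoproj_sum V (v : V) x : \sum_(s : G) s x *: isoproj s v = bact v x.
Proof.
rewrite {2}(coord_vbasis (memvf x)) bact_sumr.
under eq_bigr => s _ do rewrite scaler_sumr.
rewrite exchange_big /=; apply: eq_bigr => i _.
rewrite bact_alg -C_coord scaler_suml; apply: eq_bigr => s _.
by rewrite scalerA mulrC.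
Qed.

Lemma isoproj1 V (v : V) : \sum_(s : G) isoproj s v = v.
Proof.
rewrite -[RHS]bact1 -isoproj_sum.
by apply: eq_bigr => s _; rewrite rmorph1 scale1r.
Qed.

(** [isoproj_sum] applied to [b_i * x] gives terms in t(b_i) t(x); summing against [C i s] keeps
    only t = s, by [C_delta]. *)
Lemma bact_isoproj V s (v : V) x : bact (isoproj s v) x = s x *: isoproj s v.
Proof.
rewrite {1}/isoproj bact_suml.
under eq_bigr => i _ do
  rewrite bactZ -bactM -isoproj_sum scaler_sumr.
rewrite exchange_big /= (bigD1 s) //= [X in _ + X]big1 ?addr0 => [|t ts];
  under eq_bigr => i _ do rewrite rmorphM scalerA mulrA.
all: by rewrite -scaler_suml -mulr_suml C_delta ?eqxx ?mul1r // eq_sym (negPf ts) mul0r scale0r.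
Qed.

Lemma isoproj_scalar V s t (v : V) :
  (forall x, bact v x = t x *: v) -> isoproj s v = (s == t)%:R *: v.
Proof.
move=> vt; rewrite /isoproj; under eq_bigr => i _ do rewrite vt scalerA.
by rewrite -scaler_suml C_delta.
Qed.

Lemma isoproj_idem V s (v : V) : isoproj s (isoproj s v) = isoproj s v.
Proof.
by rewrite (isoproj_scalar s (bact_isoproj s v)) eqxx scale1r.
Qed.

Lemma isoproj_equivariant V W (f : 'Hom(V, W)) s v :
  equivariant f -> f (isoproj s v) = isoproj s (f v).
Proof.
move=> eqf; rewrite linear_sum; apply: eq_bigr => i _.
by rewrite linearZ /= eqf.
Qed.

Definition isotypic V s : {vspace V} := limg (linfun (@isoproj V s)).

Lemma mem_isotypic V s v : v \in isotypic V s -> isoproj s v = v.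
Proof. by case/memv_imgP => w _ ->; rewrite lfunE /= isoproj_idem. Qed.

Lemma isoproj_in V s (v : V) : isoproj s v \in isotypic V s.
Proof. by rewrite -(lfunE (@isoproj V s)) memv_img ?memvf. Qed.

Lemma bact_isotypic V s v x : v \in isotypic V s -> bact v x = s x *: v.
Proof. by move/mem_isotypic <-; exact: bact_isoproj. Qed.

Lemma isotypic_scalar V s t : (forall (v : V) x, bact v x = t x *: v) ->
  \dim (isotypic V s) = ((s == t) * \dim {:V})%N.
Proof.
move=> Vt; case: eqVneq => [-> | st]; rewrite ?mul1n ?mul0n.
  congr (\dim _); apply/eqP; rewrite eqEsubv subvf; apply/subvP => v _.
  by have := isoproj_in t v; rewrite (isoproj_scalar t (Vt v)) eqxx scale1r.
apply/eqP; rewrite dimv_eq0 -subv0; apply/subvP => v /mem_isotypic <-.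
by rewrite (isoproj_scalar s (Vt v)) (negPf st) scale0r mem0v.
Qed.

(** Rank-nullity for g on the s-component of W: naturality of the projections identifies its image
    with the s-component of S, and its kernel with the image under f of that of V. *)
Lemma isotypic_exact V W S s : short_exact V W S ->
  \dim (isotypic W s) = (\dim (isotypic V s) + \dim (isotypic S s))%N.
Proof.
case=> f [g [eqf eqg f0 fg g1]].
rewrite -(limg_ker_dim g (isotypic W s)); congr (_ + _)%N; last first.
  congr (\dim _); apply/eqP; rewrite eqEsubv; apply/andP; split; apply/subvP => v.
    by case/memv_imgP => w /mem_isotypic <- ->; rewrite isoproj_equivariant ?isoproj_in.
  move=> /mem_isotypic; have : v \in limg g by rewrite g1 memvf.
  by case/memv_imgP => w _ -> <-; rewrite -isoproj_equivariant // memv_img ?isoproj_in.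
rewrite -(@limg_dim_eq _ _ _ f (isotypic V s)) ?f0 ?capv0 //.
congr (\dim _); apply/eqP; rewrite eqEsubv -fg; apply/andP; split; apply/subvP => v.
  rewrite memv_cap => /andP[/mem_isotypic + /memv_imgP[w _ vE]].
  by rewrite vE => <-; rewrite -isoproj_equivariant // memv_img ?isoproj_in.
case/memv_imgP => w /mem_isotypic <- ->; rewrite memv_cap memv_img ?memvf // andbT.
by rewrite isoproj_equivariant ?isoproj_in.
Qed.

Lemma isotypic_comp_series W (c : seq (bimod K)) s : comp_series W c ->
  \dim (isotypic W s) = (\sum_(T <- c) \dim (isotypic T s))%N.
Proof.
elim=> {W c} [W W0 | V W S c _ ex _ IH].
  by rewrite big_nil; apply/eqP; rewrite -leqn0 -W0 dimvS // subvf.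
by rewrite big_cons (isotypic_exact s ex) IH addnC.
Qed.

Lemma isotypic_iso V W s : bimod_iso V W -> \dim (isotypic V s) = \dim (isotypic W s).
Proof.
case=> f eqf [f0 f1]; rewrite -(@limg_dim_eq _ _ _ f (isotypic V s)) ?f0 ?capv0 //.
congr (\dim _); apply/eqP; rewrite eqEsubv; apply/andP; split; apply/subvP => v.
  by case/memv_imgP => w /mem_isotypic <- ->; rewrite isoproj_equivariant ?isoproj_in.
move=> /mem_isotypic; have : v \in limg f by rewrite f1 memvf.
by case/memv_imgP => w _ -> <-; rewrite -isoproj_equivariant // memv_img ?isoproj_in.
Qed.

Lemma isotypic_neq0 V : \dim {:V} != 0%N -> exists s, isotypic V s != 0%VS.
Proof.
move=> V0; apply: contrapT => /forallNP H; case/negP: V0.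
rewrite dimv_eq0 -subv0; apply/subvP => v _; rewrite -(isoproj1 v) memv_suml // => s _.
by have /negP := H s; rewrite negbK => /eqP <-; exact: isoproj_in.
Qed.

(** Source of simple objects: on an isotypic component the right action is by scalars, so every line
    in it is a sub-bimodule. *)
Lemma line_stable V s v : v \in isotypic V s ->
  forall u x, u \in <[v]>%VS -> bact u x \in <[v]>%VS.
Proof.
move=> vs _ x /vlineP[a ->]; rewrite bactZ (bact_isotypic _ vs) scalerA.
by rewrite memvZ ?memv_line.
Qed.

Lemma simple_line V s v (vs : v \in isotypic V s) : v != 0 ->
  simple_bimod (sub_bimod (line_stable vs)).
Proof.
move=> v0; split; rewrite ?dim_sub_bimod ?dim_vline ?v0 // => U _.
have : (\dim U <= 1)%N.
  by rewrite (leq_trans (dimvS (subvf U))) // dim_sub_bimod dim_vline v0.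
rewrite leq_eqVlt ltnS leqn0 dimv_eq0 => /orP[/eqP U1 | /eqP]; last by left.
right; apply/eqP; rewrite eqEdim subvf U1 dim_sub_bimod dim_vline.
by case: (_ != _).
Qed.

(** [homogeneous] only constrains composition factors, so exploiting it takes a composition series.
    Induction on the dimension, taking off a one-dimensional quotient. *)
Lemma comp_series_exists W : exists c, comp_series W c.
Proof.
have [d] := ubnP (\dim {:W}); elim: d W => // d IH W; rewrite ltnS => Wd.
have [W0 | W0] := eqVneq (\dim {:W}) 0%N; first by exists [::]; constructor.
have [s sW] := isotypic_neq0 W0; pose v := vpick (isotypic W s).
have vs : v \in isotypic W s by exact: memv_pick.
have v0 : v != 0 by rewrite vpick0.
pose S := sub_bimod (line_stable vs).
(* A linear projection onto the line of v need not be equivariant; preceded by the projection onto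
   the s-component, where the right action is scalar, it is. *)
pose g0 (w : W) : S := vsproj <[v]> (projv <[v]> (isoproj s w)).
have g0l : linear g0 by move=> a x y; rewrite /g0 !linearP.
pose gl := HB.pack_for {linear W -> S} g0 (GRing.isLinear.Build _ _ _ _ g0 g0l).
pose g := linfun gl.
have gE w : g w = g0 w by rewrite lfunE.
have eqg : equivariant g.
  move=> w x; rewrite !gE; apply: subvs_inj.
  rewrite val_sub_bimod /g0 !vsprojK ?memv_proj //.
  (* The projection commutes with the right action because K is commutative. *)
  have -> : isoproj s (bact w x) = s x *: isoproj s w.
    rewrite -bact_isoproj /isoproj bact_suml.
    by apply: eq_bigr => i _; rewrite bactZ -!bactM mulrC.
  rewrite linearZ /=; apply/esym/(@bact_isotypic _ s).
  have /vlineP[a ->] := memv_proj <[v]> (isoproj s w).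
  by rewrite memvZ.
have g1 : limg g = fullv.
  apply/eqP; rewrite eqEsubv subvf; apply/subvP => y _.
  suff -> : y = g (vsval y) by rewrite memv_img ?memvf.
  rewrite gE /g0; have /vlineP[a yE] := subvsP y.
  rewrite mem_isotypic; last by rewrite yE memvZ.
  by rewrite projv_id ?subvsP // vsvalK.
have st : forall w x, w \in lker g -> bact w x \in lker g.
  move=> w x; rewrite !memv_ker eqg => /eqP ->.
  by rewrite bact0l.
have Wlt : (\dim {:sub_bimod st} < d)%N.
  rewrite dim_sub_bimod (leq_trans _ Wd) // -(limg_ker_dim g fullv) g1 capfv.
  by rewrite dim_sub_bimod dim_vline v0 addn1.
have [c cW] := IH _ Wlt; exists (S :: c).
apply: Comp_cons cW; first exact: simple_line.
exists (linfun (@vsval _ _ (lker g))), g; split=> // [w x | | ].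
- by rewrite !lfunE /= val_sub_bimod.
- by apply/eqP/lker0P => x y; rewrite !lfunE => /subvs_inj.
apply/eqP; rewrite eqEsubv; apply/andP; split; apply/subvP => w.
  by case/memv_imgP => y _ ->; rewrite lfunE subvsP.
move=> wg; rewrite -(vsprojK wg).
by rewrite -[vsval _](lfunE (@vsval _ _ (lker g))) memv_img ?memvf.
Qed.

(** A nonzero isotypic component is a sub-bimodule, hence everything; then every line is a
    sub-bimodule, which forces dimension 1. *)
Lemma simple_bimod_char S : simple_bimod S ->
  exists s, \dim {:S} = 1%N /\ forall (v : S) x, bact v x = s x *: v.
Proof.
case=> S0 simS; have [s sS] := isotypic_neq0 S0; exists s.
have Ss (v : S) x : bact v x = s x *: v.
  have [|sS0|sS1] := simS (isotypic S s); last by apply: (@bact_isotypic S s); rewrite sS1 memvf.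
    by move=> u y us; rewrite (bact_isotypic _ us) memvZ.
  by rewrite sS0 eqxx in sS.
split=> //; pose v := vpick (isotypic S s).
have [|/eqP|<-] := simS <[v]>%VS.
- exact: line_stable (memv_pick _).
- by rewrite -dimv_eq0 dim_vline vpick0 sS.
- by rewrite dim_vline vpick0 sS.
Qed.

(** By additivity, each term S_i of the series adds one dimension to the s_i-component of W, and the
    other S_j add nothing as s is injective. So W determines q. *)
Lemma rank_eq_isotypic r W (S : 'I_r -> bimod K) (q : 'I_r -> nat) (s : 'I_r -> G) :
  injective s -> (forall i t, \dim (isotypic (S i) t) = (t == s i)) ->
  rank_eq W S q -> forall i, q i = \dim (isotypic W (s i)).
Proof.
move=> s_inj dimS [t cW tq] i; rewrite -tq (isotypic_comp_series _ cW) big_map.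
under eq_bigr => j _ do rewrite dimS (inj_eq s_inj).
rewrite -sum1_count big_mkcond; apply: eq_bigr => j _ /=.
by rewrite eq_sym; case: eqVneq.
Qed.

(** All terms of a composition series of V are isomorphic to S, so additivity kills every component
    but that of s, and the projection at s is the identity. *)
Lemma homogeneous_scalar V S s : (forall t, \dim (isotypic S t) = (t == s)) ->
  homogeneous S V -> forall (v : V) x, bact v x = s x *: v.
Proof.
move=> dimS homV v x; have [c cV] := comp_series_exists V.
have V0 t : t != s -> isoproj t v = 0.
  move=> ts; apply/eqP; rewrite -memv0.
  suff /eqP <- : isotypic V t == 0%VS by exact: isoproj_in.
  rewrite -dimv_eq0 (isotypic_comp_series t cV).
  have: forall c1 T c2, c = c1 ++ T :: c2 -> \dim (isotypic T t) = 0%N.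
    move=> c1 T c2 cE; rewrite (@isotypic_iso T S) ?dimS ?(negPf ts) //.
    by apply: homV; exists c1, c2; rewrite -cE.
  elim: c {cV} => [|T c IH] c0; first by rewrite big_nil.
  rewrite big_cons (c0 [::] T c) // add0n IH // => c1 U c2 cE.
  by apply: (c0 (T :: c1) U c2); rewrite cE.
by rewrite -(isoproj1 v) (bigD1 s) //= big1 ?addr0 ?bact_isoproj.
Qed.

(** The s_i-component of V is the copy of V_i spanned by the free rows of [dec_basis D i]. *)
Lemma dim_isotypic_dec n (phi : alghom K n) r (S : 'I_r -> bimod K)
    (D : decomposition phi S) (s : 'I_r -> G) : injective s ->
  (forall i x, dec_hom D i x = (s i x)%:M) ->
  forall i, \dim (isotypic (bimod_of phi) (s i)) = dec_dim D i.
Proof.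
move=> s_inj DE i; pose f j := linfun (mulmxr (dec_basis D j) : 'rV_ _ -> 'rV[K]_n).
have fs j (u : 'rV_(dec_dim D j)) : isoproj (s i) (f j u : bimod_of phi) = (i == j)%:R *: f j u.
  rewrite -(inj_eq s_inj); apply: isoproj_scalar => x.
  by rewrite !lfunE /= /bact /= -mulmxA -dec_homE DE mul_scalar_mx scalemxAr.
have <- : limg (f i) = isotypic (bimod_of phi) (s i).
  apply/eqP; rewrite eqEsubv; apply/andP; split; apply/subvP => w.
    case/memv_imgP => u _ ->; have := fs i u; rewrite eqxx scale1r => <-.
    exact: (@isoproj_in (bimod_of phi)).
  move=> /(@mem_isotypic (bimod_of phi)) <-.
  (* Decompose w along the V_j: only its part in V_i survives the projection. *)
  have /sub_sumsmxP[u ->] := submx_full w (dec_full D).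
  rewrite linear_sum memv_suml // => j _.
  have /submxP[y ->] : (u j *m <<dec_basis D j>> <= dec_basis D j)%MS.
    by rewrite (submx_trans (submxMl _ _)) ?genmxE.
  have := fs j y; rewrite lfunE /= => ->.
  case: eqVneq y => [<- y | _ y]; last by rewrite scale0r mem0v.
  by rewrite scale1r -[_ *m _](lfunE (mulmxr (dec_basis D i) : 'rV_ _ -> 'rV[K]_n)) memv_img ?memvf.
rewrite limg_dim_eq; first by rewrite dimvf dim_matrix mul1r.
have /eqP lk0 : lker (f i) == 0%VS; last by rewrite [lker _]lk0 capv0.
by apply/lker0P => x y; rewrite !lfunE /=; apply: (row_free_inj (dec_free D i)).
Qed.

End Isotypic.

(** * Increasing index maps *)

Section Incr.
Variables m n : nat.
Implicit Types f g : incr m n.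

Lemma incr_lt f (i j : 'I_m) : (i < j)%N -> (val f i < val f j)%N.
Proof. by move=> ij; have /forallP/(_ i)/forallP/(_ j)/implyP := valP f; exact. Qed.

Lemma incr_inj f : injective (val f).
Proof.
move=> i j fij; apply/val_inj; case: (ltngtP i j) => // /(incr_lt f);
  by rewrite fij ltnn.
Qed.

(** An increasing map is determined by its image: the lists of values are strictly sorted and both
    of length m, so inclusion makes them equal. *)
Lemma incr_eq f g : (forall i, exists j, val f i = val g j) -> f = g.
Proof.
move=> fg; pose l h := [seq val (val (h : incr m n) i) | i <- enum 'I_m].
have l_sorted h : sorted ltn (l h).
  rewrite sorted_map; apply: (@sub_sorted _ (relpre val ltn)) => [i j|]; first exact: incr_lt.
  by rewrite -sorted_map val_enum_ord iota_ltn_sorted.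
have l_uniq h : uniq (l h) by exact: (sorted_uniq ltn_trans ltnn).
have sub_l : {subset l f <= l g}.
  move=> _ /mapP[i _ ->]; have [j ->] := fg i.
  by apply/mapP; exists j; rewrite ?mem_enum.
have [_ l_eq] := uniq_min_size (l_uniq f) sub_l (eq_leq (etrans (size_map _ _) (esym (size_map _ _)))).
have /eq_in_map lE := irr_sorted_eq ltn_trans ltnn (l_sorted f) (l_sorted g) l_eq.
by apply/val_inj/ffunP => i; apply/val_inj/lE; rewrite mem_enum.
Qed.

End Incr.

(** * Exterior powers in coordinates *)

Section Submod.
Variable R : comPzRingType.
Local Open Scope classical_set_scope.

Lemma rspan_sub n (X N : set 'rV[R]_n) :
  is_submod N -> X `<=` N -> rspan X `<=` N.
Proof.
move=> [N0 NZ] XN _ [t [c [U [UX ->]]]]; rewrite mulmx_sum_row.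
elim/big_ind: _ => // [x y Nx Ny | j _]; first by rewrite -[x]scale1r; exact: NZ.
by rewrite -[X in N X]addr0; apply: NZ => //; exact: XN.
Qed.

Lemma rspan1 n (x : 'rV[R]_n) : rspan [set x] = range (fun a => a *: x).
Proof.
apply/seteqP; split=> [| _ [a _ <-]].
  apply: rspan_sub => [|_ ->]; last by exists 1; rewrite ?scale1r.
  split=> [|a _ _ [u _ <-] [v _ <-]]; first by exists 0; rewrite ?scale0r.
  by exists (a * u + v); rewrite // scalerDl scalerA.
exists 1%N, a%:M, x; split; last by rewrite mul_scalar_mx.
by move=> j; rewrite /= row_id.
Qed.

Lemma wedge_mul m n (C : 'M[R]_m) (B : 'M[R]_(m, n)) :
  wedge (C *m B) = \det C *: wedge B.
Proof. by apply/rowP => s; rewrite !mxE -mulmx_colsub det_mulmx. Qed.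

(** Any m vectors in the row span of B form a matrix [C *m B], whose wedge is det C times that of
    B. *)
Lemma ext_image_free m n (B : 'M[R]_(m, n)) :
  ext_image m (range (fun c : 'rV[R]_m => c *m B)) = rspan [set wedge B].
Proof.
apply/seteqP; split; last first.
  rewrite rspan1 => _ [a _ <-]; exists 1%N, a%:M, (wedge B).
  split; last by rewrite mul_scalar_mx.
  by move=> j; exists B; rewrite ?row_id // => i; exists (delta_mx 0 i); rewrite // -rowE.
apply: rspan_sub => [|_ [U UB <-]].
  rewrite rspan1; split=> [|a _ _ [u _ <-] [v _ <-]]; first by exists 0; rewrite ?scale0r.
  by exists (a * u + v); rewrite // scalerDl scalerA.
have /choice[c cE] : forall j, exists c, c *m B = row j U.
  by move=> j; have [c _ <-] := UB j; exists c.
rewrite rspan1; exists (\det (\matrix_j c j)) => //=; rewrite -wedge_mul.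
by congr wedge; apply/row_matrixP => j; rewrite row_mul rowK.
Qed.

(** The rows are the standard basis vectors indexed by the values of f, so their wedge product is
    the basis vector e_f of the exterior power. *)
Definition std_mx m n (f : incr m n) : 'M[R]_(m, n) := rowsub (val f) 1%:M.

Lemma det_std_mx m n (f g : incr m n) :
  \det (colsub (val g) (std_mx f)) = (f == g)%:R.
Proof.
have [<- | fg] := eqVneq.
  rewrite -[RHS](det1 _ m); congr (\det _); apply/matrixP => i j.
  by rewrite !mxE (inj_eq (@incr_inj _ _ f)).
(* Some value of f is missed by g, which leaves a zero row in the minor. *)
have /existsP[i /forallP gi] : [exists i, forall j, val f i != val g j].
  apply: contra_neqT fg => /existsPn H; apply: incr_eq => i.
  by have /forallPn[j /negPn/eqP] := H i; exists j.
rewrite (expand_det_row _ i) big1 // => j _.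
by rewrite !mxE (negPf (gi j)) mul0r.
Qed.

(** Plücker expansion: the coefficients lie in R while the [std_mx] come from the base field, the
    form that [inv_generated] asks for. *)
Lemma wedge_std m n (U : 'M[R]_(m, n)) :
  wedge U = \sum_s wedge U 0 s *: wedge (std_mx (enum_val s)).
Proof.
apply/rowP => s; rewrite summxE (bigD1 s) //= big1 => [|t ts].
  by rewrite !mxE det_std_mx eqxx mulr1 addr0.
by rewrite !mxE det_std_mx (inj_eq enum_val_inj) (negPf ts) mulr0.
Qed.

End Submod.

Lemma map_std_mx (R R' : comPzRingType) (h : {rmorphism R -> R'}) m n (f : incr m n) :
  map_mx h (std_mx R f) = std_mx R' f.
Proof. by rewrite map_mxsub map_mx1. Qed.

Lemma row_free_std_mx (F : fieldType) m n (f : incr m n) : row_free (std_mx F f).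
Proof.
apply/row_freeP; exists (std_mx F f)^T; apply/matrixP => i j.
rewrite !mxE (bigD1 (val f i)) //= big1 ?addr0 => [|c ci].
  by rewrite !mxE eqxx mul1r (inj_eq (@incr_inj _ _ f)) eq_sym.
by rewrite !mxE eq_sym (negPf ci) mul0r.
Qed.

(** * The functors of a set of scalar matrices *)

Section ScalarAlgebra.
Variables (K : fieldType) (n : nat) (A : set 'M[K]_n).
Hypothesis A_scalar : forall a, A a -> is_scalar_mx a.
Local Open Scope classical_set_scope.

Lemma FA_scalar m (R : kalg K) : FA A m R = Gr m n R.
Proof.
apply/seteqP; split=> [M [] // | M GrM]; split=> // a u /A_scalar/is_scalar_mxP[x ->] Mu.
rewrite map_scalar_mx mul_mx_scalar.
have [_ [[M0 MZ] _]] := GrM.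
by rewrite -[_ *: u]addr0; exact: MZ.
Qed.

(* The exterior product of a basis of [M] is the combination, with its minors as
   coefficients, of those of the coordinate subspaces, which are all invariant. *)
Lemma GA_scalar m (R : kalg K) : GA A m R = Gr m n R.
Proof.
apply/seteqP; split=> [M [] // | M GrM]; split=> //.
have [[B [_ ->]] _] := GrM.
exists #|{: incr m n}|, (wedge B 0), (fun s => std_mx K (enum_val s)); split.
  move=> s; split=> [|a /A_scalar/is_scalar_mxP[x ->]]; first exact: row_free_std_mx.
  by rewrite mul_mx_scalar scalemx_sub.
rewrite ext_image_free {1}(wedge_std B); congr rspan; congr classical_sets.set1.
by apply: eq_bigr => s _; rewrite map_std_mx.
Qed.

Lemma HA_scalar m (R : kalg K) : HA A m R = Gr m n R.
Proof. by rewrite /HA FA_scalar GA_scalar setIid. Qed.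

End ScalarAlgebra.

(** * Multiplicities in the Galois case, and the theorem *)

Lemma same_char_iso (k : fieldType) (K : fieldExtType k) (V W : bimod K) (s : K -> K) :
  \dim {:V} = \dim {:W} -> (forall (v : V) x, bact v x = s x *: v) ->
  (forall (w : W) x, bact w x = s x *: w) -> bimod_iso V W.
Proof.
move=> dimVW Vs Ws.
(* Any linear isomorphism will do: it is equivariant because both right actions are scalar through
   the same s. *)
have [f0 fX] := linear_of_free (vbasis {:V}) (vbasis {:W}).
pose f : 'Hom(V, W) := linfun f0.
have f1 : limg f = fullv.
  rewrite -(span_basis (vbasisP {:V})) limg_span -[RHS](span_basis (vbasisP {:W})).
  congr (span _); rewrite -fX ?(basis_free (vbasisP _)) ?size_tuple //.
  by apply: eq_map => v; rewrite lfunE.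
exists f; first by move=> v x; rewrite Vs Ws linearZ.
split=> //; apply/eqP; rewrite -dimv_eq0 -(eqn_add2r (\dim (limg f))).
by rewrite -{1}(capfv (lker f)) limg_ker_dim f1 add0n dimVW.
Qed.

Section Galois.
Variables (k : fieldType) (K : splittingFieldType k) (n r : nat) (phi : alghom K n).
Variable (S : 'I_r -> bimod K).
Hypothesis galK : galois 1%VS {:K}%VS.
Hypothesis simS : forall i, simple_bimod (S i).
Hypothesis isoS : forall i j, bimod_iso (S i) (S j) -> i = j.

Lemma dim_simple i : \dim {:S i} = 1%N.
Proof.
have [C [Cd Cx]] := gal_dual galK.
by have [s []] := simple_bimod_char Cd Cx (simS i).
Qed.

(** Hides the choice of the dual family C and of the automorphisms s_i: [m W i] is the dimension of
    the s_i-component of W. *)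
Lemma isotypic_multiplicities (D : decomposition phi S) :
  exists m : bimod K -> 'I_r -> nat,
   [/\ forall W q, rank_eq W S q -> q = m W, m (bimod_of phi) = dec_dim D
     & forall i x, is_scalar_mx (dec_hom D i x)].
Proof.
have [C [Cd Cx]] := gal_dual galK.
have /choice[s sE] i := simple_bimod_char Cd Cx (simS i).
(* Two of the S_i with the same automorphism are isomorphic, both having dimension 1. *)
have s_inj : injective s.
  move=> i j sij; apply: isoS; have [di ci] := sE i; have [dj cj] := sE j.
  by apply: (same_char_iso (s := s i)); rewrite ?di // sij.
have dimS i t : \dim (isotypic C (S i) t) = (t == s i).
  by have [di ci] := sE i; rewrite (isotypic_scalar Cd Cx t ci) di muln1.
have DE i x : dec_hom D i x = (s i x)%:M.
  apply/row_matrixP => j; rewrite rowE.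
  have /= := homogeneous_scalar Cd Cx (dimS i) (@dec_homog _ _ _ _ _ _ D i) (delta_mx 0 j) x.
  by rewrite /bact /= => ->; rewrite -mul_mx_scalar -rowE.
exists (fun W i => \dim (isotypic C W (s i))); split=> [W q Wq | | i x].
- by apply: funext; exact: (rank_eq_isotypic Cd Cx).
- by apply: funext; exact: (dim_isotypic_dec Cd Cx).
- by rewrite DE scalar_mx_is_scalar.
Qed.

End Galois.

Theorem corollary6p12 (k : fieldType) (K : splittingFieldType k)
  (n r : nat) (phi : alghom K n) (S : 'I_r -> bimod K) (l : 'I_r -> nat)
  (D : decomposition phi S) (W : bimod K) :
  galois 1%VS {: K}%VS ->
  (forall i, simple_bimod (S i)) ->
  (forall i j, bimod_iso (S i) (S j) -> i = j) ->
  rank_eq (bimod_of phi) S l ->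
  (forall R : kalg K, Fphi D W R = Gphi D W R /\ Gphi D W R = Hphi D W R) /\
  (forall q : 'I_r -> nat, rank_eq W S q ->
     nat_iso (Fphi D W) (prod_Gr q l)).
Proof.
move=> galK simS isoS Vl; have [m [mE mV scal]] := isotypic_multiplicities galK simS isoS D.
have A_scalar i a : range (dec_hom D i) a -> is_scalar_mx a.
  by case=> x _ <-; exact: scal.
(* Both sides are the multiplicities [m] of V. *)
have lE : l = dec_dim D by rewrite (mE _ _ Vl) mV.
split=> [R | q Wq].
  split; apply/seteqP; split=> M [q' Wq' MX]; exists q' => // i; have := MX i;
    by rewrite ?(FA_scalar (A_scalar i)) ?(GA_scalar (A_scalar i)) ?(HA_scalar (A_scalar i)).
(* The q' hidden in [Fphi] must be q, and the S_i have dimension 1, so the ranks q_i m_i are the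
   q_i. *)
have FE R : Fphi D W R = prod_Gr q (dec_dim D) R.
  apply/seteqP; split=> M.
    move=> [q' Wq' MF] i; have := MF i.
    by rewrite (FA_scalar (A_scalar i)) (dim_simple galK simS) muln1 (mE _ _ Wq') -(mE _ _ Wq).
  move=> MG; exists q => // i; rewrite (FA_scalar (A_scalar i)) (dim_simple galK simS) muln1.
  exact: MG.
(* Once l is replaced, both functors consist of families in the same modules, and the identity is
   the isomorphism. *)
rewrite lE; exists (fun R M => M); split=> [R|//].
by rewrite FE; split=> // M MG; exists M.
Qed.
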